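(* There exists a locally finite metric space which is of superexponential growth and which is supramenable.
   Context: A metric space is locally finite if its subsets of finite diameter are finite. For a locally finite metric space $X$, a point $x\in X$ and $r\ge 0$, let $\beta^X_x(r)$ be the cardinality of the closed ball of radius $r$ around $x$. The space $X$ is of superexponential growth if $\limsup_{r\to\infty}\beta^X_x(r)^{1/r}=\infty$ (this holds for some $x\in X$ if and only if it holds for all $x\in X$). For a metric space $(A,d)$, let $\mathcal{W}(A)$ be the set of all bijections $\gamma\colon S\to T$ between subsets $S,T$ of $A$ with $\sup_{x\in S}d(\gamma(x),x)<\infty$. A locally finite metric space $A$ is amenable if there exists a finitely additive map $\mu$ from the set of all subsets of $A$ to $[0,1]$ with $\mu(A)=1$ and $\mu(T)=\mu(S)$ for every $\gamma\colon S\to T$ in $\mathcal{W}(A)$. A locally finite metric space $X$ is supramenable if every non-empty subspace $A$ of $X$ (with the restricted metric) is amenable. *)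

(* Defs.v *)
From HB Require Import structures.
From mathcomp Require Import all_boot all_order all_algebra.
From mathcomp Require Import finmap.
From mathcomp Require Import all_classical all_reals all_analysis.

Set Implicit Arguments.
Unset Strict Implicit.
Unset Printing Implicit Defensive.

Import Order.TTheory GRing.Theory Num.Theory.
Import numFieldNormedType.Exports.

Local Open Scope classical_set_scope.
Local Open Scope ring_scope.

(* The restricted metric on a subset, compatible with the library's
   pseudometric structure on [set_type A]. *)
Section SubspaceMetric.
Context {R : realType} {X : metricType R} (A : set X).

Definition sub_mdist (x y : A) : R := mdist (val x) (val y).

Lemma sub_mdist_ge0 (x y : A) : 0 <= sub_mdist x y.
Proof. exact: mdist_ge0. Qed.

Lemma sub_mdist_positivity (x y : A) : sub_mdist x y = 0 -> x = y.
Proof. by move=> xy0; apply: val_inj; exact: mdist_positivity xy0. Qed.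

Lemma ball_sub_mdist (x : A) (e : R) : ball x e = [set y | sub_mdist x y < e].
Proof. by rewrite /ball/= /initial_ball set_valE ballEmdist. Qed.

HB.instance Definition _ := @PseudoMetric_isMetric.Build R (A : Type)
  sub_mdist sub_mdist_ge0 sub_mdist_positivity ball_sub_mdist.

End SubspaceMetric.

Section Definitions.
Context {R : realType}.

Definition diameter (X : metricType R) (S : set X) : \bar R :=
  ereal_sup [set (mdist x y)%:E | x in S & y in S].

Definition locally_finite (X : metricType R) : Prop :=
  forall S : set X, (diameter S < +oo)%E -> finite_set S.

(* Not [closed_ball], which is the topological closure of the open ball. *)
Definition metric_closed_ball (X : metricType R) (x : X) (r : R) : set X :=
  [set y | mdist x y <= r].

(* [fset_set] of an infinite set is empty; in a locally finite space closed
   balls are finite and this is the actual cardinality. *)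
Definition ball_growth (X : metricType R) (x : X) (r : R) : nat :=
  #|` fset_set (metric_closed_ball x r)|.

(* In a locally finite space the condition does not depend on the base point.
   Quantifying over it existentially excludes the empty space. *)
Definition superexponential_growth (X : metricType R) : Prop :=
  exists x : X,
    limf_esup (fun r : R => (((ball_growth x r)%:R : R) `^ r^-1)%:E)
              (pinfty_nbhs R) = +oo%E.

(* [g] represents a bijection from [S] onto [T]; its values outside [S] are
   irrelevant. *)
Definition wobbling (X : metricType R) (S T : set X) (g : X -> X) : Prop :=
  set_bij S T g /\ (ereal_sup [set (mdist (g x) x)%:E | x in S] < +oo)%E.

Definition amenable (X : metricType R) : Prop :=
  exists mu : set X -> R,
    [/\ forall S, 0 <= mu S <= 1,
        forall S T, S `&` T = set0 -> mu (S `|` T) = mu S + mu T,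
        mu [set: X] = 1 &
        forall (S T : set X) (g : X -> X), wobbling S T g -> mu T = mu S].

Definition supramenable (X : metricType R) : Prop :=
  forall A : set X, A !=set0 -> amenable (A : Type).

End Definitions.

(* Main.v *)
(* If only finitely many points of a metric space have another point within
   distance [r], for each [r], then a map at bounded distance from the identity
   moves only finitely many points. On an infinite such space every
   nonprincipal ultrafilter is therefore an invariant mean; finite subspaces
   carry the normalized counting measure, and the hypothesis passes to
   subspaces. It holds for the ultrametric [max (level x) (level y)] of any
   proper level function, whose balls may grow arbitrarily fast: the level
   chosen here puts [k ^ k] points in the ball of radius [k]. *)
Require Import Defs.
From HB Require Import structures.
From mathcomp Require Import all_boot all_order all_algebra.
From mathcomp Require Import finmap.
From mathcomp Require Import all_classical all_reals all_analysis.

Set Implicit Arguments.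
Unset Strict Implicit.
Unset Printing Implicit Defensive.

Import Order.TTheory GRing.Theory Num.Theory.

Local Open Scope classical_set_scope.
Local Open Scope ring_scope.

(** Turns the extended-real finiteness conditions on diameters and displacements into real bounds;
    for empty [E] the supremum is [-oo] and any bound serves. *)
Lemma ereal_sup_EFin_lty (R : realType) (E : set R) :
  (ereal_sup (EFin @` E) < +oo)%E -> has_ubound E.
Proof.
move=> Efin; have [//|unb] := pselect (has_ubound E).
have [E0|E0] := pselect (E !=set0).
  by move: Efin; rewrite (hasNub_ereal_sup unb E0).
by exists 0 => x Ex; case: E0; exists x.
Qed.

Section AsymptoticallyDiscrete.
Context {R : realType}.

Definition asymptotically_discrete (X : metricType R) : Prop :=
  forall r : R, finite_set [set x : X | exists2 y, x != y & mdist x y <= r].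

(** A point of the ball other than the centre has the centre within [r], so it lies in the finite
    exceptional set. *)
Lemma finite_metric_closed_ball (X : metricType R) (x : X) (r : R) :
  asymptotically_discrete X -> finite_set (metric_closed_ball x r).
Proof.
move=> dX.
have : finite_set (x |` [set y | exists2 z, y != z & mdist y z <= r]).
  by rewrite finite_setU; split; [exact: finite_set1|exact: dX].
apply: sub_finite_set => y xyr; have [->|yx] := eqVneq y x; first by left.
by right; exists x => //; rewrite metric_sym.
Qed.

Lemma asymptotically_discrete_locally_finite (X : metricType R) :
  asymptotically_discrete X -> locally_finite X.
Proof.
move=> dX S diamS.
have [->|/set0P[x0 Sx0]] := eqVneq S set0; first exact: finite_set0.
have [r rP] : has_ubound [set mdist x y | x in S & y in S].
  apply: ereal_sup_EFin_lty; apply: le_lt_trans diamS; apply: le_ereal_sup.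
  by move=> _ [_ [x Sx [y Sy <-]] <-]; exists x => //; exists y.
apply: sub_finite_set (finite_metric_closed_ball x0 r dX) => x Sx.
by apply: rP; exists x0 => //; exists x.
Qed.

Lemma asymptotically_discrete_sub (X : metricType R) (A : set X) :
  asymptotically_discrete X -> asymptotically_discrete (A : Type).
Proof.
move=> dX r; have := @finite_preimage _ _ _ (val : A -> X) _ (dX r).
move=> /(_ (in2W val_inj)); apply: sub_finite_set => x [y xy dxy].
by exists (val y); first by rewrite (inj_eq val_inj).
Qed.

Lemma wobbling_card (X : metricType R) (S T : set X) (g : X -> X) :
  wobbling S T g -> (T #= S)%card.
Proof.
move=> [[gST ginj gsurj] _]; rewrite (_ : T = g @` S).
  by apply: inj_card_eq => x y; exact: ginj.
by apply/seteqP; split=> // _ [x Sx <-]; exact: gST.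
Qed.

Lemma finite_amenable (X : metricType R) :
  finite_set [set: X] -> [set: X] !=set0 -> amenable X.
Proof.
move=> finX [x0 _].
have fin (S : set X) : finite_set S by exact: sub_finite_set finX.
pose card (S : set X) : R := #|` fset_set S|%:R.
have cardT_gt0 : 0 < card setT.
  rewrite ltr0n cardfs_gt0; apply/fset0Pn; exists x0.
  by rewrite in_fset_set// inE.
exists (fun S => card S / card setT); split => [S|S T ST0||S T g wST].
- rewrite divr_ge0 ?ler0n//= ler_pdivrMr// mul1r ler_nat.
  by apply: fsubset_leq_card; rewrite -fset_set_sub.
- rewrite -mulrDl /card -natrD; congr (_%:R / _).
  by rewrite -cardfsUI -fset_setU// -fset_setI// ST0 fset_set0 cardfs0 addn0.
- by rewrite divff// gt_eqF.
- by rewrite /card; have/(fcard_eq (fin T) (fin S)) -> := wobbling_card wST.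
Qed.

Lemma wobbling_ultrafilter (X : metricType R) (F : set_system X)
    (S T : set X) (g : X -> X) :
  asymptotically_discrete X -> Filter F -> @frechet_filter X `<=` F ->
  wobbling S T g -> F S <-> F T.
Proof.
move=> dX FF cofF [[gST _ gsurj] supg].
have [r rP] : has_ubound [set mdist (g x) x | x in S].
  apply: ereal_sup_EFin_lty; apply: le_lt_trans supg; apply: le_ereal_sup.
  by move=> _ [_ [x Sx <-] <-]; exists x.
have close x : S x -> mdist (g x) x <= r by move=> Sx; apply: rP; exists x.
(* On this cofinite set [g] and its inverse can only fix points, so [S] and [T] have the same trace
   on [D]. *)
pose D : set X := ~` [set x | exists2 y, x != y & mdist x y <= r].
have FD : F D by apply: cofF; rewrite /frechet_filter/= /D setCK; exact: dX.
split=> [FS|FT].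
- apply: (filterS _ (filterI FS FD)) => x [Sx Dx].
  have [gx|gx] := eqVneq (g x) x; first by rewrite -gx; exact: gST.
  case: Dx; exists (g x); first by rewrite eq_sym.
  by rewrite metric_sym close.
- apply: (filterS _ (filterI FT FD)) => _ [/gsurj[x Sx <-] Dgx].
  have [->//|gx] := eqVneq (g x) x.
  by case: Dgx; exists x => //; exact: close.
Qed.

Lemma infinite_amenable (X : metricType R) :
  asymptotically_discrete X -> infinite_set [set: X] -> amenable X.
Proof.
move=> dX infX.
have [F [UF cofF]] := ultraFilterLemma (frechet_properfilter infX).
have PF : ProperFilter F by exact: ultra_proper.
have Fdisj S T : S `&` T = set0 -> F S -> ~ F T.
  move=> ST0 FS FT; apply: (filter_not_empty F).
  by rewrite -ST0; exact: filterI.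
(* The mean takes only the values 0 and 1, with value 1 exactly on members of [F]. *)
exists (fun S => `[< F S >]%:R); split => [S|S T ST0||S T g wST].
- by case: `[< F S >]; rewrite /= lexx ler01.
- have [FS|nFS] := asboolP (F S).
    rewrite (asboolF (Fdisj _ _ ST0 FS)) addr0 asboolT//.
    by apply: filterS FS => x; left.
  rewrite add0r; congr ((nat_of_bool _)%:R).
  apply: asbool_equiv_eq; split=> [FST|]; last by apply: filterS => x; right.
  (* Additivity rests on maximality of [F]: if the complement of [S] is in [F], meeting it with the
     union leaves a part of [T]. *)
  have [//|FCS] := in_ultra_setVsetC S UF.
  by apply: (filterS _ (filterI FST FCS)) => x [[]].
- by rewrite asboolT//; exact: filterT.
- congr ((nat_of_bool _)%:R); apply: asbool_equiv_eq; apply: iff_sym.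
  exact: wobbling_ultrafilter wST.
Qed.

End AsymptoticallyDiscrete.

Lemma asymptotically_discrete_supramenable (R : realType) (X : metricType R) :
  asymptotically_discrete X -> supramenable X.
Proof.
move=> dX A [a Aa]; have [finA|infA] := pselect (finite_set [set: A]).
  by apply: finite_amenable finA _; exists (SigSub (mem_set Aa)).
exact: infinite_amenable (asymptotically_discrete_sub A dX) infA.
Qed.

Lemma exists_ltn_expnn (n : nat) : exists k, (n < k ^ k)%N.
Proof. by exists n.+1; rewrite -[leqLHS]expn1 leq_pexp2l. Qed.

(** Chosen so that the points of level at most [k] are exactly the [n < k ^ k]. *)
Definition level (n : nat) : nat := ex_minn (exists_ltn_expnn n).

Lemma ltn_expnn_level (n : nat) : (n < level n ^ level n)%N.
Proof. by rewrite /level; case: ex_minnP. Qed.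

Lemma level_leq (n k : nat) : (n < k ^ k)%N -> (level n <= k)%N.
Proof. by move=> nk; rewrite /level; case: ex_minnP => m _; exact. Qed.

Lemma leq_expnn (m n : nat) : (m <= n)%N -> (m ^ m <= n ^ n)%N.
Proof.
(* Zero is treated apart: [0 ^ 0 = 1], and monotonicity in the base needs a positive exponent. *)
case: m => [|m] mn; first by case: n mn => // n _; rewrite expn_gt0.
apply: (@leq_trans (n ^ m.+1)); rewrite ?leq_exp2r//.
by rewrite leq_pexp2l// (leq_trans _ mn).
Qed.

Lemma finite_level_leq (k : nat) : finite_set [set n | (level n <= k)%N].
Proof.
apply: (sub_finite_set _ (finite_II (k ^ k))) => n /= nk.
exact: leq_trans (ltn_expnn_level n) (leq_expnn nk).
Qed.

(* [0 ^ 0 = 1], so [0] is the only point of level [0]. *)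
Lemma level_eq0 (n : nat) : (level n == 0%N) = (n == 0%N).
Proof.
apply/eqP/eqP => [n0|->]; last by apply/eqP; rewrite -leqn0 level_leq.
by have := ltn_expnn_level n; rewrite n0; case: n {n0}.
Qed.

(** A copy of [nat] to carry its own metric; [R] ties it to the real type of its distances. *)
Definition level_space (R : realType) : Type := nat.

Section LevelSpace.
Context (R : realType).

Definition level_dist (m n : level_space R) : R :=
  if m == n :> nat then 0 else (maxn (level m) (level n))%:R.

Lemma level_distxx m : level_dist m m = 0.
Proof. by rewrite /level_dist eqxx. Qed.

Lemma level_dist_eq0 m n : level_dist m n = 0 -> m = n.
Proof.
rewrite /level_dist; case: eqP => // mn /eqP.
by rewrite pnatr_eq0 -leqn0 geq_max !leqn0 !level_eq0 => /andP[/eqP-> /eqP->].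
Qed.

Lemma level_distC m n : level_dist m n = level_dist n m.
Proof. by rewrite /level_dist eq_sym maxnC. Qed.

Lemma level_dist_triangle n m p :
  level_dist m p <= level_dist m n + level_dist n p.
Proof.
rewrite /level_dist; have [_|mp] := eqVneq (m : nat) p.
  by rewrite addr_ge0//; case: ifP.
have [<-|mn] := eqVneq (m : nat) n; first by rewrite (negbTE mp) add0r.
have [->|np] := eqVneq (n : nat) p; first by rewrite addr0.
(* The three points are now distinct: the first distance dominates the level of [m], the second that
   of [p]. *)
rewrite -natrD ler_nat geq_max; apply/andP; split.
- exact: leq_trans (leq_maxl _ _) (leq_addr _ _).
- exact: leq_trans (leq_maxr _ _) (leq_addl _ _).
Qed.

HB.instance Definition _ := Choice.copy (level_space R) nat.

HB.instance Definition _ := isMetric.Build R (level_space R)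
  level_distxx level_dist_eq0 level_distC level_dist_triangle.

Lemma level_space_asymptotically_discrete :
  asymptotically_discrete (level_space R).
Proof.
move=> r; apply: (sub_finite_set _ (finite_level_leq (Num.truncn r))).
move=> m [n mn]; rewrite /mdist/= /level_dist (negbTE mn) => mnr.
rewrite truncn_ge_nat; last exact: le_trans mnr.
by apply: le_trans mnr; rewrite ler_nat leq_maxl.
Qed.

Lemma level_space_ball_growth (k : nat) :
  (k ^ k <= ball_growth (0%N : level_space R) k%:R)%N.
Proof.
have sub : `I_(k ^ k) `<=` metric_closed_ball (0%N : level_space R) k%:R.
  move=> n nk; rewrite /metric_closed_ball/mdist/= /level_dist.
  (* Both levels are at most [k]; for the centre this uses [0 <= n < k ^ k]. *)
  case: ifP => // _; rewrite ler_nat geq_max !level_leq//.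
  exact: leq_ltn_trans nk.
apply: leq_card_fset_set; last exact: subset_card_le.
exact: finite_metric_closed_ball level_space_asymptotically_discrete.
Qed.

Lemma level_space_superexponential_growth :
  superexponential_growth (level_space R).
Proof.
(* The limsup is an infimum of suprema over neighbourhoods [V] of infinity, so each supremum must be
   infinite; [V] contains the ray beyond [M]. *)
exists 0%N; apply/ereal_inf_pinfty => _ [V [M [_ MV]] <-] /=.
rewrite -image_comp; apply: hasNub_ereal_sup; last first.
  by eexists; exists (M + 1) => //; apply: MV; rewrite ltrDl.
move=> [B BP].
(* Exceeding [M] puts the radius [k] in [V]; exceeding [B] contradicts the bound. *)
pose k := (Num.truncn (Num.max M B)).+1.
have Bk : Num.max M B < k%:R by exact: truncnS_gt.
move: Bk; rewrite gt_max => /andP[Mk].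
apply/negP; rewrite -leNgt.
(* The [k]-th root of the [k ^ k] points in the ball is [k], so the growth value at radius [k] is at
   least [k]. *)
have kE : k%:R = (k ^ k)%:R `^ k%:R^-1 :> R.
  by rewrite natrX -powR_mulrn// -powRrM mulfV ?powRr1// pnatr_eq0.
rewrite kE; apply: le_trans (BP _ _); last by exists k%:R => //; exact: MV.
apply: ge0_ler_powR; rewrite ?invr_ge0 ?nnegrE ?ler0n// ler_nat.
exact: level_space_ball_growth.
Qed.

End LevelSpace.

Theorem mainTheorem6 (R : realType) :
  exists X : metricType R,
    [/\ locally_finite X, superexponential_growth X & supramenable X].
Proof.
have dX := @level_space_asymptotically_discrete R.
exists (level_space R); split.
- exact: asymptotically_discrete_locally_finite.
- exact: level_space_superexponential_growth.
- exact: asymptotically_discrete_supramenable.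
Qed.
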